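(* Let $n\ge 2$. For each K-arc $K_n(p/q,r/s)$ of order $n$ there is a parametric stochastic matrix $M=M(\alpha)$, $0\le\alpha\le 1$ (i.e. a single square matrix whose entries depend on the parameter $\alpha$ and which is row stochastic for every $\alpha\in[0,1]$), such that each point $\lambda=\lambda(\alpha)$ of the arc is an eigenvalue of $M=M(\alpha)$. Furthermore, if $\alpha\in(0,1)$, then $M(\alpha)$ is primitive.
   Context: A nonnegative real square matrix is (row) stochastic if every row sums to $1$. A nonnegative square matrix is primitive if it is irreducible (its directed graph is strongly connected) and the greatest common divisor of the lengths of all cycles of its directed graph is $1$. $\Theta_n\subset\mathbb{C}$ denotes the set of all individual eigenvalues of all $n$-by-$n$ stochastic matrices. $F_n:=\{p/q : 0\le p\le q\le n,\ q\geq 1,\ \gcd(p,q)=1\}$ is the set of Farey fractions of order $n$ (all fractions are written in lowest terms, with $0=0/1$ and $1=1/1$). If $x<y$ are elements of $F_n$ and no element of $F_n$ lies strictly between them, $(x,y)$ is called a Farey pair of order $n$. Two fractions $x,y\in F_n$ are Farey neighbors if $(x,y)$ or $(y,x)$ is a Farey pair. By the Karpelevič theorem (in the form due to Ito), $\Theta_n$ meets the unit circle exactly at the points $e^{2\pi \mathrm{i}x}$, $x\in F_n$, and the boundary of $\Theta_n$ consists of these points and of curvilinear arcs connecting them in circular order. For Farey neighbors $p/q$ and $r/s$, labelled so that $q<s$, $K_n(p/q,r/s)$ denotes the arc connecting $e^{2\pi\mathrm{i}p/q}$ and $e^{2\pi\mathrm{i}r/s}$; these arcs are called the K-arcs of order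 $n$. The arc is given by the parametric equation $$t^{s}\left(t^{q}-\beta\right)^{\lfloor n/q\rfloor}=\alpha^{\lfloor n/q\rfloor}\,t^{q\lfloor n/q\rfloor},\qquad \alpha\in[0,1],\ \beta:=1-\alpha .$$ Here $\lambda(\alpha)$ denotes the point of the arc corresponding to the parameter $\alpha$: it satisfies this equation with that value of $\alpha$, and, as $\alpha$ runs from $0$ to $1$, $\lambda(\alpha)$ runs continuously along the whole arc from $e^{2\pi\mathrm{i}p/q}$ (at $\alpha=0$) to $e^{2\pi\mathrm{i}r/s}$ (at $\alpha=1$). *)

(* Defs.v *)
From mathcomp Require Import all_boot all_order all_algebra.
From mathcomp Require Import all_classical all_reals all_analysis.
From mathcomp Require Import complex.

Set Implicit Arguments.
Unset Strict Implicit.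
Unset Printing Implicit Defensive.

Import Order.TTheory GRing.Theory Num.Theory numFieldNormedType.Exports.

Local Open Scope classical_set_scope.
Local Open Scope complex_scope.
Local Open Scope ring_scope.

Definition nonneg_mx (R : realType) (m : nat) (A : 'M[R]_m) : Prop :=
  forall i j, 0 <= A i j.

Definition stochastic (R : realType) (m : nat) (A : 'M[R]_m) : Prop :=
  nonneg_mx A /\ forall i, \sum_j A i j = 1.

Definition mx_arc (R : realType) (m : nat) (A : 'M[R]_m) : rel 'I_m :=
  fun i j => A i j != 0.

Definition irreducible_mx (R : realType) (m : nat) (A : 'M[R]_m) : Prop :=
  forall i j : 'I_m, connect (mx_arc A) i j.

(* A directed cycle has no repeated vertex, so its length is between 1 and m;
   loops are cycles of length 1. The gcd of no lengths is 0. *)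
Definition gcd_cycle_lengths (R : realType) (m : nat) (A : 'M[R]_m) : nat :=
  \big[gcdn/0%N]_(1 <= k < m.+1 |
     [exists c : k.-tuple 'I_m, ucycleb (mx_arc A) c]) k.

Definition primitive_mx (R : realType) (m : nat) (A : 'M[R]_m) : Prop :=
  [/\ nonneg_mx A, irreducible_mx A & gcd_cycle_lengths A = 1%N].

Definition lowest_terms (p q : nat) : bool := (0 < q)%N && coprime p q.

Definition ratio_of (p q : nat) : rat := p%:R / q%:R.

Definition farey (n : nat) : set rat :=
  [set x | exists p q : nat,
     [/\ (p <= q)%N, (q <= n)%N, lowest_terms p q & x = ratio_of p q]].

Definition farey_pair (n : nat) (x y : rat) : Prop :=
  [/\ farey n x, farey n y, x < y &
      forall z : rat, farey n z -> ~ (x < z /\ z < y)].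

Definition farey_neighbors (n : nat) (x y : rat) : Prop :=
  farey_pair n x y \/ farey_pair n y x.

(* The point e^(2 pi i p/q) of the unit circle. *)
Definition circle_point (R : realType) (p q : nat) : R[i] :=
  let theta := 2 * pi * (p%:R / q%:R) : R in cos theta +i* sin theta.

Definition karc_equation (R : realType) (n q s : nat) (a : R) (t : R[i]) : Prop :=
  t ^+ s * (t ^+ q - (1 - a)%:C) ^+ (n %/ q)
    = a%:C ^+ (n %/ q) * t ^+ (q * (n %/ q)).

(* lam is the parametrization alpha |-> lambda(alpha) of K_n(p/q, r/s); its
   values outside [0, 1] are irrelevant. The equation has several roots for
   each alpha: continuity and the two endpoints select the branch.
   The alias R[i]^o carries the usual (norm) topology of the complex plane. *)
Definition karc_param (R : realType) (n p q r s : nat) (lam : R -> R[i]) : Prop :=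
  [/\ {within `[0, 1], continuous (lam : R -> R[i]^o)},
      forall a : R, 0 <= a <= 1 -> karc_equation n q s a (lam a),
      lam 0 = circle_point R p q &
      lam 1 = circle_point R r s].

(* Main.v *)
Require Import Defs.
From mathcomp Require Import all_boot all_order all_algebra.
From mathcomp Require Import all_classical all_reals all_analysis.
From mathcomp Require Import complex zify ring lra.

(* Put [d = n %/ q], so that [1 <= d <= s] because Farey neighbours satisfy
   [n < q + s].  The chain has a directed cycle P_0, ..., P_(s-1) of length [s]
   and [d] disjoint cycles L_(i,0) -> L_(i,q-1) -> ... -> L_(i,0) of length [q].
   From P_i ([i < d]) and from L_(i,0) it moves to L_(i,q-1) with probability
   [1 - a] and to P_(i+1) with probability [a]; all other moves are certain.
   Its characteristic polynomial is t^s (t^q - (1 - a))^d - a^d t^(q d), so every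
   solution of the K-arc equation is an eigenvalue, whatever the branch.  For
   [t <> 0] the right eigenvector is explicit; for [t = 0], which also solves the
   equation, P_0 and L_(0,0) have equal rows.  When [0 < a < 1] the graph is
   strongly connected and has cycles of the coprime lengths [q] and [s]. *)

Import Order.TTheory GRing.Theory Num.Theory.
Local Open Scope ring_scope.

(** * Farey neighbours and their denominators *)

Lemma ratio_of_lt (p q r s : nat) : (0 < q)%N -> (0 < s)%N ->
  (ratio_of p q < ratio_of r s) = (p * s < r * q)%N.
Proof.
move=> q0 s0; rewrite /ratio_of ltr_pdivrMr ?ltr0n// mulrAC.
by rewrite ltr_pdivlMr ?ltr0n// -!natrM ltr_nat.
Qed.

Lemma ratio_of_inj (p q r s : nat) : lowest_terms p q -> lowest_terms r s ->
  ratio_of p q = ratio_of r s -> q = s.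
Proof.
move=> /andP[q0 cpq] /andP[s0 crs] e.
have E : (p * s = r * q)%N.
  have := ltxx (ratio_of r s); rewrite -{1}e ratio_of_lt// => /negbT.
  have := ltxx (ratio_of r s); rewrite -{2}e ratio_of_lt// => /negbT.
  lia.
apply/eqP; rewrite eqn_dvd; apply/andP; split.
  by rewrite -(@Gauss_dvdr q p) 1?coprime_sym// E dvdn_mull.
by rewrite -(@Gauss_dvdr s r) 1?coprime_sym// -E dvdn_mull.
Qed.

Lemma farey_denom (n p q : nat) : lowest_terms p q -> farey n (ratio_of p q) ->
  (q <= n)%N.
Proof.
move=> lpq [p' [q' [_ le_q'n lpq' e]]].
by rewrite (ratio_of_inj _ _ _ _ lpq lpq' e).
Qed.

(** The fraction [x / y] exceeds [p / q] by exactly [1 / (q y)], and [y] lies in the window of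
    length [q] ending at [n]: it is the candidate for the right neighbour of [p / q]. *)
Lemma bezout_window (n p q : nat) : lowest_terms p q -> (q <= n)%N ->
  exists x y : nat, [/\ (q * x = p * y + 1)%N, (y <= n)%N & (n < q + y)%N].
Proof.
move=> /andP[q0 cpq] le_qn.
have [u v e _] := egcdnP p q0.
have gE : gcdn q p = 1%N by apply/eqP; rewrite -/(coprime q p) coprime_sym.
rewrite gE in e.
have ltv := ltn_pmod v q0.
(* The largest number up to [n] that is congruent to the Bezout coefficient [v] modulo [q]. *)
pose y := ((n - v %% q) %/ q * q + v %% q)%N.
have dq : (q %| p * y + 1)%N.
  rewrite /dvdn -modnDml -modnMmr /y modnMDl modn_mod modnMmr modnDml.
  by rewrite (mulnC p) -e modnMl.
exists ((p * y + 1) %/ q)%N, y; split.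
- by rewrite mulnC divnK.
- rewrite /y; have := leq_divM (n - v %% q) q; lia.
- rewrite /y; have := divn_eq (n - v %% q) q.
  have := ltn_pmod (n - v %% q) q0; lia.
Qed.

(** Compare [r / s] with the Bezout fraction [x / y]. If [x / y] is smaller, it lies strictly inside
    the pair; if it is larger, the gap [1 / (q y)] is too small to contain [r / s]. So the two
    agree. *)
Lemma farey_pair_det (n p q r s : nat) : lowest_terms p q -> lowest_terms r s ->
  farey_pair n (ratio_of p q) (ratio_of r s) ->
  (q * r = p * s + 1)%N /\ (n < q + s)%N.
Proof.
move=> lpq lrs [fpq frs lt_pq_rs nomid].
have leq_qn := farey_denom _ _ _ lpq fpq.
have leq_sn := farey_denom _ _ _ lrs frs.
have [x [y [exy ley lty]]] := bezout_window _ _ _ lpq leq_qn.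
have /andP[q0 cpq] := lpq; have /andP[s0 crs] := lrs.
have y0 : (0 < y)%N by lia.
have lxy : lowest_terms x y.
  rewrite /lowest_terms y0 /= /coprime -dvdn1.
  rewrite -(@dvdn_addr (p * y)) ?dvdn_mull ?dvdn_gcdr//.
  by rewrite -exy dvdn_mull ?dvdn_gcdl.
have le_rs : (r <= s)%N.
  have [r' [s' [le' _ /andP[s'0 _] e]]] := frs.
  have : ~~ (ratio_of r' s' < ratio_of r s) by rewrite e ltxx.
  by rewrite ratio_of_lt//; nia.
rewrite ratio_of_lt// in lt_pq_rs.
have [lt|gt|eq] := ltngtP (x * s) (r * y).
- exfalso; apply: (nomid (ratio_of x y)); last by rewrite !ratio_of_lt//; split; lia.
  by exists x, y; split => //; nia.
- exfalso.
  (* [x/y - p/q = 1/(qy)] cannot be [>= 1/(sy) + 1/(qs)], as [q + y > n >= s] *)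
  have h1 : (q * (r * y + 1) <= q * (x * s))%N by rewrite leq_mul2l; lia.
  have h2 : (y * (p * s + 1) <= y * (r * q))%N by rewrite leq_mul2l; lia.
  have h3 : (q * x * s = (p * y + 1) * s)%N by rewrite exy.
  nia.
have exy' : ratio_of x y = ratio_of r s.
  apply: le_anti; rewrite !leNgt !ratio_of_lt//; lia.
have eys : y = s := ratio_of_inj _ _ _ _ lxy lrs exy'.
subst y; split=> //.
suff -> : r = x by [].
by apply/eqP; rewrite -(eqn_pmul2r s0) eq.
Qed.

(** Coprimality will give period 1; the two bounds will give [1 <= n %/ q <= s]. *)
Lemma farey_neighbors_coprime (n p q r s : nat) :
  lowest_terms p q -> lowest_terms r s ->
  farey_neighbors n (ratio_of p q) (ratio_of r s) ->
  [/\ coprime q s, (q <= n)%N & (n < q + s)%N].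
Proof.
have gcd1 (a b c e : nat) : (a * b = c * e + 1)%N -> coprime a e.
  move=> E; rewrite /coprime -dvdn1 -(@dvdn_addr (c * e)).
    by rewrite -E dvdn_mulr ?dvdn_gcdl.
  by rewrite dvdn_mull ?dvdn_gcdr.
move=> lpq lrs [] F; have [fpq frs _ _] := F.
  have [/gcd1 ? ?] := farey_pair_det _ _ _ _ _ lpq lrs F.
  by split=> //; apply: farey_denom lpq fpq.
have [/gcd1 ? ?] := farey_pair_det _ _ _ _ _ lrs lpq F.
by split; [rewrite coprime_sym | apply: farey_denom lpq frs | rewrite addnC].
Qed.

(** * Chains that choose between two maps *)

(** The indicators are added, so a state with [f x = g x] moves with certainty and needs no separate
    case. *)
Definition two_map_mx (R : realType) (T : finType) (f g : T -> T) (a : R) :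
    'M[R]_#|T| :=
  \matrix_(i, j) ((1 - a) * (enum_val j == f (enum_val i))%:R
                  + a * (enum_val j == g (enum_val i))%:R).

Lemma sum_enum_val_delta (R : nzRingType) (T : finType) (h : T -> R) (y : T) :
  \sum_(j < #|T|) (enum_val j == y)%:R * h (enum_val j) = h y.
Proof.
rewrite (bigD1 (enum_rank y)) //= enum_rankK eqxx mul1r big1 ?addr0// => j jy.
case: eqP => [e|_]; last by rewrite mul0r.
by rewrite -e enum_valK eqxx in jy.
Qed.

Lemma two_map_stochastic (R : realType) (T : finType) (f g : T -> T) (a : R) :
  0 <= a <= 1 -> stochastic (two_map_mx R T f g a).
Proof.
move=> a01; split=> [i j|i].
  by rewrite mxE addr_ge0// mulr_ge0//; lra.
have delta1 y := sum_enum_val_delta R T (fun=> 1) y.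
rewrite (eq_bigr (fun j => (1 - a) * ((enum_val j == f (enum_val i))%:R * 1)
                  + a * ((enum_val j == g (enum_val i))%:R * 1))); last first.
  by move=> j _; rewrite mxE !mulr1.
by rewrite big_split/= -!mulr_sumr !delta1; ring.
Qed.

Lemma two_map_arc (R : realType) (T : finType) (f g : T -> T) (a : R) (x y : T) :
  0 < a < 1 -> (y == f x) || (y == g x) ->
  mx_arc (two_map_mx R T f g a) (enum_rank x) (enum_rank y).
Proof.
move=> a01; rewrite /mx_arc mxE !enum_rankK.
by case: (y == f x); case: (y == g x) => //= _; apply/lt0r_neq0; lra.
Qed.

(** [eigenvalue] speaks of row vectors; were [t] not an eigenvalue, [A - t] would be invertible and
    yet kill [v]. *)
Lemma eigenvalue_right (F : fieldType) (m : nat) (A : 'M[F]_m) (t : F)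
    (v : 'cV[F]_m) :
  v != 0 -> A *m v = t *: v -> eigenvalue A t.
Proof.
move=> v0 Av; apply/negP => /eqP ker0.
have : A - t%:M \in unitmx by rewrite -row_free_unit -kermx_eq0 [kermx _]ker0.
move=> /mulKmx /(_ v) ; rewrite mulmxBl Av mul_scalar_mx subrr mulmx0 => e.
by rewrite -e eqxx in v0.
Qed.

Lemma two_map_eigenvalue (R : realType) (T : finType) (f g : T -> T) (a : R)
    (t : R[i]) (h : T -> R[i]) (x0 : T) :
  h x0 != 0 ->
  (forall x, real_complex R (1 - a) * h (f x) + real_complex R a * h (g x)
             = t * h x) ->
  eigenvalue (map_mx (real_complex R) (two_map_mx R T f g a)) t.
Proof.
move=> hx0 E; apply: (@eigenvalue_right _ _ _ _ (\col_i h (enum_val i))).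
  apply/eqP => /matrixP /(_ (enum_rank x0) 0); rewrite !mxE enum_rankK => e.
  by rewrite e eqxx in hx0.
apply/matrixP => i k; rewrite !mxE -E.
rewrite -[h (f _)]sum_enum_val_delta -[h (g _)]sum_enum_val_delta !mulr_sumr.
rewrite -big_split; apply: eq_bigr => j _ /=.
by rewrite !mxE rmorphD !rmorphM !rmorph_nat; ring.
Qed.

Lemma two_map_eigenvalue0 (R : realType) (T : finType) (f g : T -> T) (a : R)
    (x y : T) :
  x != y -> f x = f y -> g x = g y ->
  eigenvalue (map_mx (real_complex R) (two_map_mx R T f g a)) 0.
Proof.
move=> xy fxy gxy; apply/eigenvalueP.
exists (delta_mx 0 (enum_rank x) - delta_mx 0 (enum_rank y)); last first.
  apply/eqP => /matrixP /(_ 0 (enum_rank x)); rewrite !mxE !eqxx/=.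
  rewrite (inj_eq enum_rank_inj) (negbTE xy) subr0 => /eqP.
  by rewrite oner_eq0.
rewrite mulmxBl -!rowE scale0r; apply/eqP; rewrite subr_eq0; apply/eqP.
by apply/rowP => j; rewrite !mxE !enum_rankK fxy gxy.
Qed.

(** * Cycles and the gcd of their lengths *)

Lemma ucycle_mkseq (T : eqType) (e : rel T) (c : nat -> T) (k : nat) :
  {in [pred i | (i < k.+1)%N] &, injective c} ->
  (forall i, (i <= k)%N -> e (c i) (c i.+1)) -> c k.+1 = c 0%N ->
  ucycle e (mkseq c k.+1).
Proof.
move=> inj step wrap; apply/andP; split; last exact/mkseq_uniqP.
(* The closing vertex [c 0] is read as [c k.+1], so the cycle becomes a path through consecutive
   values of [c]. *)
rewrite /mkseq /= -{2}wrap -map_rcons -cats1 -[[:: k.+1]]/(iota (1 + k) 1) -iotaD addn1.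
have nthE i : (i <= k)%N -> nth (c 0%N) [seq c i | i <- iota 1 k.+1] i = c i.+1.
  by move=> ik; rewrite (nth_map 0%N) ?size_iota// nth_iota// add1n.
apply/(pathP (c 0%N)); rewrite size_map size_iota => -[|i] ik.
  by rewrite nthE//; apply: step.
by rewrite nthE// -[nth _ (_ :: _) _]/(nth _ _ i) nthE 1?ltnW//; apply: step.
Qed.

Lemma gcd_cycle_lengths_dvd (R : realType) (m : nat) (A : 'M[R]_m)
    (c : seq 'I_m) :
  (0 < size c)%N -> ucycle (mx_arc A) c ->
  (gcd_cycle_lengths A %| size c)%N.
Proof.
move=> c0 cyc.
have uc : uniq c by case/andP: cyc.
(* Without repeated vertices, the length falls in the index range of the gcd. *)
have cm : (size c <= m)%N.
  by rewrite -(card_uniqP uc) -[X in (_ <= X)%N](card_ord m) max_card.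
rewrite /gcd_cycle_lengths (big_rem (size c)) /=; last first.
  by rewrite mem_index_iota c0 ltnS.
rewrite ifT ?dvdn_gcdl//.
by apply/existsP; exists (in_tuple c).
Qed.

Lemma two_map_cycle_dvd (R : realType) (T : finType) (f g : T -> T) (a : R)
    (c : nat -> T) (k : nat) :
  0 < a < 1 ->
  {in [pred i | (i < k.+1)%N] &, injective c} ->
  (forall i, (i <= k)%N -> (c i.+1 == f (c i)) || (c i.+1 == g (c i))) ->
  c k.+1 = c 0%N ->
  (gcd_cycle_lengths (two_map_mx R T f g a) %| k.+1)%N.
Proof.
move=> a01 inj step wrap.
rewrite -(size_mkseq (fun i => enum_rank (c i)) k.+1).
apply: gcd_cycle_lengths_dvd; first by rewrite size_mkseq.
apply: ucycle_mkseq; last by rewrite wrap.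
  by move=> i j ik jk /enum_rank_inj; apply: inj.
by move=> i ik; apply: two_map_arc => //; exact: step.
Qed.

(** * The chain of a K-arc and its eigenvectors *)

(* The arguments [d], [q], [s] of the chain are the predecessors of the number of
   loops, of their length and of the length of the long cycle: [inl i] is P_i and
   [inr (i, j)] is L_(i,j). *)
Definition karc_state (d q s : nat) : finType :=
  ('I_s.+1 + 'I_d.+1 * 'I_q.+1)%type.

(** [ord_pred] sends [ord0] to [ord_max], which closes the loop. [stay] and [advance] differ only at
    P_i with [i <= d] and at L_(i,0). *)
Definition stay (d q s : nat) (x : karc_state d q s) : karc_state d q s :=
  match x with
  | inl i => if (i <= d)%N then inr (inord i, ord_max) else inl (ordS i)
  | inr (i, j) => inr (i, ord_pred j)
  end.

Definition advance (d q s : nat) (x : karc_state d q s) : karc_state d q s :=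
  match x with
  | inl i => inl (ordS i)
  | inr (i, j) => if j == ord0 then inl (ordS (inord i)) else inr (i, ord_pred j)
  end.

(* [G ^+ i] is the eigenvector at P_i for [i <= d], and [t ^+ i / t ^+ s.+1] for
   [i > d].  At [a = 0] the equation forces [t ^+ q.+1 = b], and the convention
   [0 / 0 = 0] then makes [G = 0], which is the right value. *)
Lemma karc_loop_identity (F : fieldType) (d q s : nat) (a b t : F) (i : nat) :
  t != 0 ->
  t ^+ s.+1 * (t ^+ q.+1 - b) ^+ d.+1 = a ^+ d.+1 * t ^+ (q.+1 * d.+1) ->
  let G := (t ^+ q.+1 - b) / (a * t ^+ q) in
  (i <= d)%N ->
  (t ^+ q.+1 - b) * G ^+ i
    = a * t ^+ q * (if (i.+1 <= d)%N then G ^+ i.+1 else t ^+ i.+1 / t ^+ s.+1).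
Proof.
move=> t0 E G le_id; set u := t ^+ q.+1 - b in E G *.
have ts0 : t ^+ s.+1 != 0 by rewrite expf_eq0 (negbTE t0) andbF.
have tq0 : t ^+ q != 0 by rewrite expf_eq0 (negbTE t0) andbF.
have [a0|a0] := eqVneq a 0.
  have : u ^+ d.+1 = 0.
    by apply: (mulfI ts0); rewrite E a0 expr0n !mul0r mulr0.
  by move/eqP; rewrite expf_eq0 /= => /eqP ->; rewrite a0 !mul0r.
have w0 : a * t ^+ q != 0 by rewrite mulf_neq0.
case: ltnP => [_|le_di]; first by rewrite exprS mulrA [_ * G]mulrC divfK.
(* Below [d] the identity is the definition of [G]; at [i = d], where the two forms of the
   eigenvector meet, it is the K-arc equation. *)
have -> : i = d by apply/eqP; rewrite eqn_leq le_id.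
rewrite /G; set w := a * t ^+ q in w0 *.
have wd0 : w ^+ d != 0 by rewrite expf_eq0 (negbTE w0) andbF.
have Ew : t ^+ s.+1 * u ^+ d.+1 = w ^+ d.+1 * t ^+ d.+1.
  by rewrite E /w exprMn -mulrA -exprM -exprD; congr (_ * _ ^+ _); lia.
apply: (mulfI wd0); apply: (mulfI ts0).
have -> : t ^+ s.+1 * (w ^+ d * (u * (u / w) ^+ d)) = t ^+ s.+1 * u ^+ d.+1.
  by rewrite expr_div_n [u ^+ d.+1]exprS; field.
rewrite Ew [w ^+ d.+1]exprS; field; exact: ts0.
Qed.

Lemma karc_eigenvalue (R : realType) (d q s : nat) (a : R) (t : R[i]) :
  (d <= s)%N ->
  t ^+ s.+1 * (t ^+ q.+1 - real_complex R (1 - a)) ^+ d.+1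
    = real_complex R a ^+ d.+1 * t ^+ (q.+1 * d.+1) ->
  eigenvalue (map_mx (real_complex R)
    (two_map_mx R _ (stay d q s) (advance d q s) a)) t.
Proof.
move=> le_ds E.
have [->|t0] := eqVneq t 0.
  apply: (@two_map_eigenvalue0 _ _ _ _ _ (inl ord0) (inr (ord0, ord0))) => //=.
    congr (inr (_, _)); apply: val_inj => /=; first by rewrite inordK.
    by rewrite modn_small.
  by congr (inl (ordS _)); apply: val_inj; rewrite /= inordK.
set b := real_complex R (1 - a) in E *; set A := real_complex R a in E *.
have bA : b + A = 1 by rewrite /b /A -rmorphD subrK rmorph1.
pose G := (t ^+ q.+1 - b) / (A * t ^+ q).
pose c i := if (i <= d)%N then G ^+ i else t ^+ i / t ^+ s.+1.
pose h (x : karc_state d q s) :=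
  match x with inl i => c i | inr (i, j) => G ^+ i / t ^+ j end.
have t_unit k : t ^+ k != 0 by rewrite expf_eq0 (negbTE t0) andbF.
(* At the wrap from P_s to P_0, [d <= s] puts [c s.+1] in the second branch, where it equals
   [1 = G ^+ 0]. *)
have c_ordS (i : 'I_s.+1) : c (ordS i) = c i.+1.
  rewrite /=; have := ltn_ord i; rewrite ltnS leq_eqVlt => /orP[/eqP->|lt_is].
    by rewrite modnn /c /= expr0 [RHS]ifF ?divff//; lia.
  by rewrite modn_small.
(* P_i and L_(i,0) have the same moves and the same value [G ^+ i], so one identity serves both. *)
have loop i : (i <= d)%N -> b * (G ^+ i / t ^+ q) + A * c i.+1 = t * G ^+ i.
  move=> le_id; have L := karc_loop_identity _ _ _ _ _ _ _ i t0 E le_id.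
  apply: (mulfI (t_unit q)); rewrite mulrDr mulrCA [t ^+ q * (_ / _)]mulrC divfK//.
  rewrite mulrA [t ^+ q * A]mulrC -L -/G.
  by move: (G ^+ i) => g; rewrite exprS; ring.
apply: (@two_map_eigenvalue _ _ _ _ _ _ h (inl ord0)).
  by rewrite /h /c /= expr0 oner_neq0.
move=> [i|[i j]]; rewrite [advance _ _ _ _]/= [stay _ _ _ _]/=.
  case: (leqP i d) => id; rewrite /h c_ordS.
    by rewrite /= inordK ?ltnS// loop// /c id.
  rewrite -mulrDl bA mul1r /c !ifF; [|lia|lia].
  by rewrite exprS mulrA.
have [->|j0] := eqVneq j ord0.
  have le_id : (i <= d)%N by rewrite -ltnS.
  rewrite /h c_ordS inordK; last by lia.
  by rewrite /= modn_small// loop// expr0 divr1.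
rewrite -mulrDl bA mul1r /h.
have jS : j = j.-1.+1 :> nat by rewrite prednK// lt0n.
have -> : ord_pred j = j.-1 :> nat.
  by rewrite /= jS addSn /= modnDr modn_small//; have := ltn_ord j; lia.
by rewrite [in RHS]jS exprS; field; rewrite t0 t_unit.
Qed.

(** * Strong connectivity and period of the chain *)

Lemma val_ord_pred (q : nat) (j : 'I_q.+1) :
  ord_pred j = (if j == ord0 then q else j.-1) :> nat.
Proof.
case: eqVneq => [->|j0] /=; first by rewrite modn_small.
rewrite -(prednK (_ : 0 < j)%N) ?lt0n// addSn /= modnDr modn_small//.
by have := ltn_ord j; lia.
Qed.

Lemma connect_dec (T : finType) (e : rel T) (c : nat -> T) (k : nat) :
  (forall i, (i < k)%N -> e (c i.+1) (c i)) ->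
  forall i j, (j <= i <= k)%N -> connect e (c i) (c j).
Proof.
move=> step; elim=> [|i IH] j /andP[ji ik].
  by move: ji; rewrite leqn0 => /eqP ->.
move: ji; rewrite leq_eqVlt => /predU1P[->//|ji].
by apply: connect_trans (connect1 (step i ik)) (IH j _); rewrite -ltnS ji ltnW.
Qed.

(** The long cycle joins all P_i. A loop is left by descending to L_(i,0) and advancing; it is
    entered from P_i at its top vertex, from which all of it is reached by descent. *)
Lemma karc_irreducible (R : realType) (d q s : nat) (a : R) :
  (d <= s)%N -> 0 < a < 1 ->
  irreducible_mx (two_map_mx R _ (stay d q s) (advance d q s) a).
Proof.
move=> le_ds a01.
pose e := mx_arc (two_map_mx R _ (stay d q s) (advance d q s) a).
have st x : e (enum_rank x) (enum_rank (stay d q s x)).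
  by apply: two_map_arc; rewrite ?eqxx.
have ad x : e (enum_rank x) (enum_rank (advance d q s x)).
  by apply: two_map_arc; rewrite ?eqxx ?orbT.
pose P i : karc_state d q s := inl (inord i).
pose L i j : karc_state d q s := inr (i, inord j).
have Pdec i j : (i <= j <= s)%N ->
    connect e (enum_rank (P i)) (enum_rank (P j)).
  move=> /andP[ij js].
  (* The long cycle runs upwards, so it is reindexed by [s - k] to fit [connect_dec]. *)
  rewrite -(subKn js) -(subKn (leq_trans ij js)).
  apply: (@connect_dec _ e (fun k => enum_rank (P (s - k)%N)) s); last by lia.
  move=> k ks; have := ad (P (s - k.+1)%N); congr (e _ (enum_rank (inl _))).
  by apply: val_inj; rewrite /= !inordK ?modn_small; lia.
have Pwrap : e (enum_rank (P s)) (enum_rank (P 0%N)).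
  have := ad (P s); congr (e _ (enum_rank (inl _))).
  by apply: val_inj; rewrite /= !inordK// modnn.
have PP (k l : 'I_s.+1) :
    connect e (enum_rank (inl k : karc_state d q s)) (enum_rank (inl l : karc_state d q s)).
  rewrite -[k]inord_val -[l]inord_val.
  apply: connect_trans (Pdec k s _) _; first by rewrite leqnn andbT -ltnS ltn_ord.
  apply: connect_trans (connect1 Pwrap) (Pdec 0%N l _).
  by rewrite /= -ltnS ltn_ord.
have Ldec i j k : (k <= j <= q)%N ->
    connect e (enum_rank (L i j)) (enum_rank (L i k)).
  apply: (@connect_dec _ e (fun j => enum_rank (L i j)) q) => l lq.
  have := st (L i l.+1); congr (e _ (enum_rank (inr (_, _)))).
  by apply: ord_inj; rewrite val_ord_pred -val_eqE /= !inordK//; lia.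
have LP i j (k : 'I_s.+1) :
    connect e (enum_rank (inr (i, j) : karc_state d q s)) (enum_rank (inl k : karc_state d q s)).
  rewrite -[j]inord_val; apply: connect_trans (Ldec i j 0%N _) _.
    by rewrite /= -ltnS ltn_ord.
  apply: connect_trans (connect1 (ad _)) _; rewrite /= ifT; first exact: PP.
  by rewrite -val_eqE /= inordK.
have PL (k : 'I_s.+1) i j :
    connect e (enum_rank (inl k : karc_state d q s)) (enum_rank (inr (i, j) : karc_state d q s)).
  apply: connect_trans (PP k (inord i)) _.
  apply: connect_trans (connect1 (st _)) _.
  have le_id : (i <= d)%N by rewrite -ltnS.
  rewrite /= inordK; last by lia.
  rewrite le_id inord_val -[j]inord_val -[ord_max]inord_val.
  by apply: Ldec; rewrite leqnn andbT -ltnS ltn_ord.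
move=> u v; rewrite -[u]enum_valK -[v]enum_valK.
move: (enum_val u) (enum_val v) => [k|[i j]] [k'|[i' j']]; last 1 first.
- exact: connect_trans (LP i j ord0) (PL _ _ _).
- exact: PP.
- exact: PL.
- exact: LP.
Qed.

Lemma karc_gcd_cycle_lengths (R : realType) (d q s : nat) (a : R) :
  coprime q.+1 s.+1 -> 0 < a < 1 ->
  gcd_cycle_lengths (two_map_mx R _ (stay d q s) (advance d q s) a) = 1%N.
Proof.
move=> cqs a01; apply/eqP; rewrite -dvdn1 -(eqP cqs) dvdn_gcd; apply/andP; split.
  (* Loop 0 starting at L_(0,0) and descending from L_(0,q); the remainder only matters at [i = 0],
     where it turns [q.+1] into 0. *)
  pose c i : karc_state d q s := inr (ord0, inord ((q.+1 - i) %% q.+1)).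
  have cE i : (0 < i <= q.+1)%N -> ((q.+1 - i) %% q.+1 = q.+1 - i)%N.
    by move=> hi; rewrite modn_small; lia.
  apply: (@two_map_cycle_dvd _ _ _ _ _ c) => //.
  - move=> i j; rewrite !inE => iq jq [] /(congr1 (@nat_of_ord _)).
    rewrite !inordK ?ltn_mod//; case: i iq => [|i] iq; case: j jq => [|j] jq //;
    rewrite ?subn0 ?modnn ?(cE i.+1) ?(cE j.+1); lia.
  - move=> i iq; apply/orP; left; apply/eqP; congr (inr (_, _)); apply: ord_inj.
    rewrite val_ord_pred -val_eqE [val ord0]/= [val _]/= !inordK ?ltn_mod//.
    rewrite (cE i.+1)//; case: i iq => [|i] iq; first by rewrite subn0 modnn subn1.
    by rewrite cE ?ifF; lia.
  - by rewrite /c subnn subn0 modnn mod0n.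
pose c i : karc_state d q s := inl (inord (i %% s.+1)).
apply: (@two_map_cycle_dvd _ _ _ _ _ c) => //.
- move=> i j; rewrite !inE => iq jq [] /(congr1 (@nat_of_ord _)).
  by rewrite !modn_small// !inordK.
- move=> i iq; apply/orP; right; apply/eqP; congr inl; apply: val_inj.
  by rewrite /= !inordK ?ltn_mod// -addn1 -modnDml addn1.
- by rewrite /c modnn mod0n.
Qed.

Theorem theorem3p2 (R : realType) (n p q r s : nat) (hn : (2 <= n)%N)
    (hpq : lowest_terms p q) (hrs : lowest_terms r s) (hqs : (q < s)%N)
    (hF : farey_neighbors n (ratio_of p q) (ratio_of r s)) :
  exists (m : nat) (M : R -> 'M[R]_m),
    [/\ forall a : R, 0 <= a <= 1 -> stochastic (M a),
        forall lam : R -> R[i], karc_param n p q r s lam ->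
          forall a : R, 0 <= a <= 1 ->
            eigenvalue (map_mx (real_complex R) (M a)) (lam a) &
        forall a : R, 0 < a < 1 -> primitive_mx (M a)].
Proof.
have [cqs le_qn lt_nqs] := farey_neighbors_coprime _ _ _ _ _ hpq hrs hF.
have q0 : (0 < q)%N by case/andP: hpq.
have d0 : (0 < n %/ q)%N by rewrite divn_gt0.
(* With [d = n %/ q], [d q <= n < q + s] gives [(d - 1) q < s]. *)
have le_ds : (n %/ q <= s)%N.
  by have := leq_divM n q; nia.
case: q s q0 hpq hrs hqs hF cqs le_qn lt_nqs d0 le_ds => [//|q] [//|s] _ _ _ _ _.
move=> cqs _ _; case dE: (n %/ q.+1)%N => [//|d] _ le_ds.
exists _, (two_map_mx R _ (stay d q s) (advance d q s)); split.
- by move=> a; apply: two_map_stochastic.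
- move=> lam [_ eqn _ _] a a01; apply: karc_eigenvalue => //.
  by have := eqn a a01; rewrite /karc_equation dE.
- move=> a a01; split; [|exact: karc_irreducible|exact: karc_gcd_cycle_lengths].
  by apply: (proj1 (two_map_stochastic _ _ _ _ _ _)); lra.
Qed.
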